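(* Let $\|\cdot\|$ be a norm on $\mathbb{R}^d$ and $T:\mathbb{R}^d\to\mathbb{R}^d$ nonexpansive with $\operatorname{Fix}T\neq\emptyset$. Let $(\beta_n)_{n\ge1}\subseteq(0,1)$ be nondecreasing with $\lim_n\beta_n=1$ (and $\beta_0=0$), such that $\sum_{j=1}^\infty(1-\beta_j)=+\infty$ and $\sum_{j=1}^n(\beta_j-\beta_{j-1})<+\infty$. Let $x^0\in\mathbb{R}^d$ and $(x^n)$ be generated by $x^n=(1-\beta_n)x^0+\beta_n(Tx^{n-1}+U_n)$, where $(U_n)$ are random vectors with $\mathbb{E}(U_n)=0$ and $\sigma_n:=\mathbb{E}(\|U_n\|)$ satisfying $\sum_{n=1}^\infty\sigma_n<+\infty$. Then: (a) $\|x^n-Tx^n\|\to0$ almost surely, and (almost surely) every accumulation point of $(x^n)$ is a fixed point of $T$. (b) If $(\mathbb{R}^d,\|\cdot\|)$ is smooth, in the sense that $\lim_{\lambda\to0}\frac{\|x+\lambda y\|-\|x\|}{\lambda}$ exists for all $x,y$ in the unit sphere, then $(x^n)$ converges almost surely to some $x^*\in\operatorname{Fix}T$. *)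

(* Defs.v *)
From HB Require Import structures.
From mathcomp Require Import all_boot all_order all_algebra.
From mathcomp Require Import all_classical all_reals all_analysis.
Set Implicit Arguments. Unset Strict Implicit. Unset Printing Implicit Defensive.
Import Order.TTheory GRing.Theory Num.Theory.
Import numFieldNormedType.Exports.
Local Open Scope ring_scope.
Local Open Scope classical_set_scope.

(* A norm on R^d (row vectors 'rV[R]_d), given as an arbitrary function
   satisfying the norm axioms (nonnegativity follows from these). *)
Definition is_norm {R : realType} {d : nat} (N : 'rV[R]_d -> R) : Prop :=
  [/\ (forall x, N x = 0 -> x = 0),
      (forall (a : R) x, N (a *: x) = `|a| * N x) &
      (forall x y, N (x + y) <= N x + N y)].

Definition nonexpansive {R : realType} {d : nat} (N : 'rV[R]_d -> R)
  (F : 'rV[R]_d -> 'rV[R]_d) : Prop :=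
  forall x y, N (F x - F y) <= N (x - y).

Definition accumulation_point {R : realType} {d : nat} (N : 'rV[R]_d -> R)
  (u : nat -> 'rV[R]_d) (p : 'rV[R]_d) : Prop :=
  forall e : R, 0 < e -> forall m : nat, exists2 n : nat, (m <= n)%N & N (u n - p) < e.

Definition smooth_norm {R : realType} {d : nat} (N : 'rV[R]_d -> R) : Prop :=
  forall x y : 'rV[R]_d, N x = 1 -> N y = 1 ->
    exists l : R, (fun lam : R => (N (x + lam *: y) - N x) / lam) @ 0^' --> l.

Fixpoint halpern {R : realType} {d : nat} {Omega : Type}
  (F : 'rV[R]_d -> 'rV[R]_d) (beta : nat -> R) (U : nat -> Omega -> 'rV[R]_d)
  (x0 : 'rV[R]_d) (n : nat) (w : Omega) : 'rV[R]_d :=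
  match n with
  | 0 => x0
  | k.+1 => (1 - beta k.+1) *: x0 + beta k.+1 *: (F (halpern F beta U x0 k w) + U k.+1 w)
  end.

(* Main.v *)
(** The noises are almost surely absolutely summable, so it is enough to treat
a fixed realization. There [N (x n.+1 - x n)] obeys a contractive recursion with
a summable error, whence [N (x n - F (x n)) --> 0] and every accumulation point
is a fixed point.

For (b), let [z] be an accumulation point, as [t] tends to 1, of the solutions of
[z_t = (1 - t) x0 + t F z_t]. Accretivity of [id - F] gives
[N (z - p) <= N (z - p + l (x0 - z))] for all fixed points [p] and [l >= 0], a
condition that, unlike the duality map, passes to the limit at once. Smoothness
reverses it to first order: [N (p - z + s (x0 - z))^2 <= N (p - z)^2 + o(s)].
By convexity of the squared norm and compactness this holds uniformly along the
iterates, and [N (x n - z)^2] satisfies the same kind of recursion. *)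

Require Import Defs.
From HB Require Import structures.
From mathcomp Require Import all_boot all_order all_algebra.
From mathcomp Require Import all_classical all_reals all_analysis.
From mathcomp Require Import measurable_realfun.
From mathcomp Require Import ring lra.
Import Order.TTheory GRing.Theory Num.Theory.
Import numFieldNormedType.Exports.
Local Open Scope ring_scope.
Local Open Scope classical_set_scope.

(** * Real sequences: summable tails and contractive recursions *)

(** A tail starting at [m] is a difference of two partial sums, and [m] can be chosen so that its
    partial sum is within [e] of their supremum. *)
Lemma bounded_sum_tail {R : realType} (c : nat -> R) (M : R) :
  (forall n, 0 <= c n) -> (forall n, \sum_(0 <= k < n) c k <= M) ->
  forall e, 0 < e ->
  exists m, forall n, (m <= n)%N -> \sum_(m <= k < n) c k <= e.
Proof.
move=> c0 cM e e0.
pose A := range (fun n => \sum_(0 <= k < n) c k).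
have Asup : has_sup A.
  split; first by exists (\sum_(0 <= k < 0) c k), 0%N.
  by exists M => _ [n _ <-].
have [_ [m _ <-] ltm] := sup_adherent e0 Asup.
exists m => n mn.
have : \sum_(0 <= k < n) c k <= sup A by apply: (sup_upper_bound Asup); exists n.
rewrite (@big_cat_nat _ _ _ m)//=; lra.
Qed.

(* [t n := s n - delta - \sum_(m <= k < n) c k] satisfies [t n.+1 <= b n * t n]:
   as long as [t n] exceeds [e / 2] it drops by [(1 - b n) * e / 2], which
   cannot go on forever since the [1 - b n] have a divergent sum. *)
Lemma recursion_eventually_le {R : realType} (s b c : nat -> R)
    (delta M : R) (n0 : nat) :
  (forall n, 0 <= b n <= 1) -> (forall n, 0 <= c n) ->
  (forall n, \sum_(0 <= k < n) c k <= M) ->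
  (forall A, exists n, A <= \sum_(0 <= k < n) (1 - b k)) ->
  (forall n, (n0 <= n)%N ->
     s n.+1 <= b n * s n + (1 - b n) * delta + c n) ->
  forall e, 0 < e -> exists m, forall n, (m <= n)%N -> s n <= delta + e.
Proof.
move=> b01 c0 cM bdiv rec e e0.
have e20 : 0 < e / 2 by lra.
have [m1 Hm1] := bounded_sum_tail c M c0 cM (e / 2) e20.
pose m := maxn n0 m1.
pose C n := \sum_(m <= k < n) c k.
have Cle n : (m <= n)%N -> 0 <= C n <= e / 2.
  move=> mn; apply/andP; split; first by apply: sumr_ge0.
  have m1m : (m1 <= m)%N by exact: leq_maxr.
  have := Hm1 n (leq_trans m1m mn); rewrite (@big_cat_nat _ _ _ m)//=.
  have : 0 <= \sum_(m1 <= k < m) c k by apply: sumr_ge0.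
  rewrite -/(C n); lra.
pose t n := s n - delta - C n.
have trec n : (m <= n)%N -> t n.+1 <= b n * t n.
  move=> mn; have := rec n (leq_trans (leq_maxl _ _) mn).
  have := Cle n mn; have := b01 n.
  rewrite /t /C big_nat_recr//= -/(C n); nra.
have [n1 mn1 tn1] : exists2 n1, (m <= n1)%N & t n1 <= e / 2.
  apply: contrapT => H.
  have tgt n : (m <= n)%N -> e / 2 < t n.
    by move=> mn; rewrite ltNge; apply/negP => tn; apply: H; exists n.
  have tdec n : t (m + n)%N <= t m - e / 2 * \sum_(m <= k < m + n) (1 - b k).
    elim: n => [|n IH]; first by rewrite addn0 big_geq// mulr0 subr0.
    have mmn : (m <= m + n)%N by rewrite leq_addr.
    have := trec _ mmn; have := tgt _ mmn; have := b01 (m + n)%N.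
    rewrite addnS big_nat_recr//=; nra.
  have [n Hn] := bdiv (\sum_(0 <= k < m) (1 - b k) + (`|t m| / (e / 2) )).
  have mono : \sum_(0 <= k < n) (1 - b k) <= \sum_(0 <= k < m + n) (1 - b k).
    rewrite [leRHS](@big_cat_nat _ _ _ n)//= ?leq_addl// lerDl.
    by apply: sumr_ge0 => k _; have := b01 k; lra.
  have := le_trans Hn mono.
  rewrite [leRHS](@big_cat_nat _ _ _ m)//= ?leq_addr// lerD2l ler_pdivrMr//.
  have := tdec n; have := tgt _ (leq_addr n m); have := ler_norm (t m); nra.
exists n1 => n nn1.
suff: t n <= e / 2 by rewrite /t; have := Cle n (leq_trans mn1 nn1); lra.
rewrite -(subnKC nn1); elim: (n - n1)%N => [|k IH]; first by rewrite addn0.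
rewrite addnS; have := trec _ (leq_trans mn1 (leq_addr k n1)).
have := b01 (n1 + k)%N; nra.
Qed.

(** * Equivalence of norms and compactness in finite dimension *)

Section NormOnRows.
Context {R : realType} {d : nat} (N : 'rV[R]_d -> R).
Hypothesis normN : is_norm N.

Lemma is_norm0 : N 0 = 0.
Proof. by case: normN => _ NZ _; rewrite -(scale0r 0) NZ normr0 mul0r. Qed.

Lemma is_normZ a x : N (a *: x) = `|a| * N x.
Proof. by case: normN. Qed.

Lemma is_normD x y : N (x + y) <= N x + N y.
Proof. by case: normN. Qed.

Lemma is_normN x : N (- x) = N x.
Proof. by rewrite -scaleN1r is_normZ normrN1 mul1r. Qed.

Lemma is_norm_ge0 x : 0 <= N x.
Proof. have := is_normD x (- x); rewrite subrr is_norm0 is_normN; lra. Qed.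

Lemma is_norm_gt0 x : x != 0 -> 0 < N x.
Proof.
move=> x0; rewrite lt_def is_norm_ge0 andbT.
by apply: contra x0 => /eqP Nx; case: normN => /(_ _ Nx) -> _ _.
Qed.

Lemma is_norm_distC x y : N (x - y) = N (y - x).
Proof. by rewrite -is_normN opprB. Qed.

Lemma is_normB x y : N (x - y) <= N x + N y.
Proof. by rewrite -(is_normN y) is_normD. Qed.

Lemma is_norm_dist_trans z x y : N (x - y) <= N (x - z) + N (z - y).
Proof. by have := is_normD (x - z) (z - y); rewrite addrA subrK. Qed.

Lemma is_norm_sum (I : Type) (r : seq I) (f : I -> 'rV[R]_d) :
  N (\sum_(i <- r) f i) <= \sum_(i <- r) N (f i).
Proof.
elim/big_ind2: _ => [|x1 x2 y1 y2 h1 h2|//]; first by rewrite is_norm0.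
by apply: le_trans (is_normD _ _) _; exact: lerD.
Qed.

Definition coord_sum (x : 'rV[R]_d) : R := \sum_i `|x ord0 i|.

Lemma is_norm_le_coord_sum : exists2 C, 0 < C & forall x, N x <= C * coord_sum x.
Proof.
exists (1 + \sum_i N (delta_mx 0 i)).
  by rewrite ltr_wpDr// sumr_ge0// => i _; exact: is_norm_ge0.
move=> x; rewrite {1}(row_sum_delta x); apply: le_trans (is_norm_sum _ _ _) _.
rewrite /coord_sum mulr_sumr; apply: ler_sum => i _.
rewrite is_normZ mulrC ler_wpM2r// (bigD1 i)//=.
have : 0 <= \sum_(j | j != i) N (delta_mx 0 j).
  by apply: sumr_ge0 => j _; exact: is_norm_ge0.
lra.
Qed.

Lemma coord_le_mx_norm (x : 'rV[R]_d) i : `|x ord0 i| <= `|x|.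
Proof.
rewrite [leRHS]/Num.norm/= mx_normrE; apply/bigmax_geP; right => /=.
by exists (ord0, i).
Qed.

Lemma is_norm_le_mx_norm : exists2 C, 0 < C & forall x : 'rV[R]_d, N x <= C * `|x|.
Proof.
have [C C0 NC] := is_norm_le_coord_sum.
exists (C * (1 + d%:R)); first by rewrite mulr_gt0// ltr_wpDr.
move=> x; apply: le_trans (NC x) _; rewrite -mulrA ler_pM2l//.
have : coord_sum x <= \sum_(i < d) `|x|.
  by apply: ler_sum => i _; exact: coord_le_mx_norm.
rewrite sumr_const card_ord -[_ *+ _]mulr_natl mulrDl mul1r.
have := normr_ge0 x; lra.
Qed.

Lemma is_norm_continuous : continuous N.
Proof.
have [C C0 NC] := is_norm_le_mx_norm.
move=> x; apply/(@cvgrPdist_lt _ R^o _ _ (nbhs_filter x)) => e e0.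
have eC0 : 0 < e / C by rewrite divr_gt0.
apply: filterS (nbhsx_ballx x (e / C) eC0) => y.
rewrite -ball_normE /ball_/= => dxy.
have Ne : N (x - y) < e.
  by apply: le_lt_trans (NC _) _; rewrite -ltr_pdivlMl// mulrC.
rewrite ltr_norml; have := is_norm_dist_trans y x 0.
have := is_norm_dist_trans x y 0; rewrite (is_norm_distC y x) !subr0; lra.
Qed.

(** By continuity [N] attains its minimum on the compact unit sphere of the sup norm. The minimum is
    positive, and its inverse is the constant. *)
Lemma mx_norm_le_is_norm : exists2 C, 0 < C & forall x : 'rV[R]_d, `|x| <= C * N x.
Proof.
pose S := [set x : 'rV[R]_d | `|x| = 1].
(* The sphere is empty when [d = 0]; every vector is then zero. *)
have [S0|/set0P Sn0] := eqVneq S set0.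
  exists 1 => // x; suff -> : x = 0 by rewrite normr0 is_norm0 mulr0.
  apply: contrapT => /eqP x0.
  suff : S (`|x|^-1 *: x) by rewrite S0.
  by rewrite /S/= normrZ normfV normr_id mulVf// normr_eq0.
have cS : compact S.
  apply: bounded_closed_compact.
    by exists 1; split => // M M1 x /= ->; exact: ltW.
  have -> : S = (fun x : 'rV[R]_d => `|x|) @^-1` [set 1] by [].
  by apply: closed_comp => [x _|]; [exact: norm_continuous|exact: closed_eq].
have [c cS0 cmin] := EVT_min_rV Sn0 cS
  (continuous_subspaceT is_norm_continuous).
rewrite inE in cS0.
have Nc : 0 < N c.
  by apply: is_norm_gt0; rewrite -normr_eq0 cS0 oner_neq0.
exists (N c)^-1; first by rewrite invr_gt0.
move=> x; have [->|x0] := eqVneq x 0; first by rewrite normr0 is_norm0 mulr0.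
have nx : 0 < `|x| by rewrite normr_gt0.
have Sx : `|x|^-1 *: x \in S.
  by rewrite inE /S/= normrZ normfV normr_id mulVf// normr_eq0.
have := cmin _ Sx; rewrite is_normZ normfV normr_id.
by rewrite !ler_pdivlMl// [N c * _]mulrC.
Qed.

Lemma bounded_has_accumulation_point (u : nat -> 'rV[R]_d) (M : R) :
  (forall n, N (u n) <= M) -> exists p, accumulation_point N u p.
Proof.
move=> uM.
have [C C0 NC] := mx_norm_le_is_norm.
have [C' C'0 NC'] := is_norm_le_mx_norm.
pose K := [set x : 'rV[R]_d | `|x| <= C * M].
have cK : compact K.
  apply: bounded_closed_compact.
    exists (C * M); split => [|A A1 x /= /le_trans]; first exact: num_real.
    by apply; exact: ltW.
  have -> : K = (fun x : 'rV[R]_d => `|x|) @^-1` [set y | y <= C * M] by [].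
  by apply: closed_comp => [x _|]; [exact: norm_continuous|exact: closed_le].
have uK : (u @ \oo) K.
  by exists 0%N => // n _ /=; apply: le_trans (NC _) _; rewrite ler_pM2l.
have [p [_ clp]] := cK _ (fmap_proper_filter u _) uK.
exists p => e e0 m.
have eC0 : 0 < e / C' by rewrite divr_gt0.
(* A cluster point meets every set of the image filter; choosing the tail from [m] on yields an
   index at least [m]. *)
have um : (u @ \oo) [set u n | n in [set n | (m <= n)%N]].
  by exists m => // n /= mn; exists n.
have [_ [[n mn <-]]] := clp _ _ um (nbhsx_ballx p (e / C') eC0).
rewrite -ball_normE /ball_/= => pu; exists n => //.
by rewrite is_norm_distC; apply: le_lt_trans (NC' _) _; rewrite -ltr_pdivlMl// mulrC.
Qed.

End NormOnRows.

(** * Squared norms along rays: convexity and smoothness *)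

Section SmoothDescent.
Context {R : realType} {d : nat} (N : 'rV[R]_d -> R).
Hypothesis normN : is_norm N.

(** The squared norm is convex along the ray, so its chord slopes from [y] increase with the step.
    The inequality between the slopes at [l] and [s] is multiplied out to avoid quotients. *)
Lemma sqr_norm_chord (y v : 'rV[R]_d) (l s : R) : 0 < l <= s ->
  s * (N (y + l *: v) ^+ 2 - N y ^+ 2) <= l * (N (y + s *: v) ^+ 2 - N y ^+ 2).
Proof.
move=> /andP[l0 ls]; have s0 : 0 < s by exact: lt_le_trans ls.
pose r := l / s.
have r01 : 0 < r /\ 0 <= 1 - r.
  by rewrite divr_gt0// subr_ge0 ler_pdivrMr// mul1r.
have lE : l = r * s by rewrite /r divfK// gt_eqF.
have yE : y + l *: v = (1 - r) *: y + r *: (y + s *: v).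
  by apply/rowP => i; rewrite !mxE lE; ring.
have H : N (y + l *: v) <= (1 - r) * N y + r * N (y + s *: v).
  rewrite yE; apply: le_trans (is_normD N normN _ _) _.
  by rewrite !is_normZ// !ger0_norm//; lra.
have H0 := is_norm_ge0 N normN (y + l *: v).
have sq : N (y + l *: v) ^+ 2 <= ((1 - r) * N y + r * N (y + s *: v)) ^+ 2.
  by rewrite ler_sqr ?nnegrE//; exact: le_trans H.
rewrite [X in _ <= X * _]lE [r * s]mulrC -mulrA ler_pM2l//.
have := mulr_ge0 (mulr_ge0 (ltW r01.1) r01.2) (sqr_ge0 (N y - N (y + s *: v))).
nra.
Qed.

(* Smoothness turns the lower bound along [- v] into an upper bound along [v]:
   the two-sided derivative is nonpositive since its left quotients are. *)
Lemma smooth_descent (u v : 'rV[R]_d) (e : R) : smooth_norm N -> 0 < e ->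
  (forall l, 0 <= l -> N u <= N (u - l *: v)) ->
  exists2 s, 0 < s & N (u + s *: v) ^+ 2 <= N u ^+ 2 + e * s.
Proof.
move=> smN e0 uv.
have [->|v0] := eqVneq v 0.
  by exists 1 => //; rewrite scaler0 addr0; lra.
have c0 := is_norm_gt0 N normN _ v0.
(* The origin cannot be normalized, but there the squared norm is quadratic in the step, and
   [s = e / N v ^+ 2] gives equality. *)
have [u0|u0] := eqVneq u 0.
  have c20 : 0 < N v ^+ 2 by rewrite exprn_gt0.
  have s0 : 0 < e / N v ^+ 2 by rewrite divr_gt0.
  exists (e / N v ^+ 2) => //.
  rewrite u0 add0r is_norm0// is_normZ// ger0_norm ?(ltW s0)//.
  set s := e / _ in s0 *; have -> : e = s * N v ^+ 2 by rewrite /s divfK// gt_eqF.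
  by rewrite le_eqVlt; apply/orP; left; apply/eqP; ring.
have a0 := is_norm_gt0 N normN _ u0.
set a := N u in uv a0 *; set c := N v in c0.
pose x := a^-1 *: u; pose y := c^-1 *: v.
have Nx : N x = 1 by rewrite is_normZ// gtr0_norm ?invr_gt0// mulVf// gt_eqF.
have Ny : N y = 1 by rewrite is_normZ// gtr0_norm ?invr_gt0// mulVf// gt_eqF.
have [l xyl] := smN x y Nx Ny.
(* A forward quotient at most [eta] gives [N (x + t *: y) <= 1 + eta * t], whose square is at most
   [1 + 3 * eta * t] because [eta * t <= 1]. Scaling back by [a ^+ 2] with the step [t * a / c] then
   requires [eta * (3 * a * c) <= e]. *)
pose eta := Num.min 1 (e / (3 * a * c)).
have eta1 : eta <= 1 by rewrite ge_min lexx.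
have ac0 : 0 < 3 * a * c by rewrite !mulr_gt0.
have eta0 : 0 < eta by rewrite lt_min ltr01 divr_gt0.
have etae : eta * (3 * a * c) <= e by rewrite -ler_pdivlMr// ge_min lexx orbT.
have eta20 : 0 < eta / 2 by lra.
have [/= del del0 Hdel] := @cvgr_dist_lt _ R^o _ _ _ _ _ xyl _ eta20.
have near0 (t : R) : t != 0 -> `|t| < del ->
    `|l - (N (x + t *: y) - N x) / t| < eta / 2.
  by move=> t0 td; apply: Hdel => //=; rewrite sub0r normrN.
have uE t : u + (t * a / c) *: v = a *: (x + t *: y).
  apply/rowP => i; rewrite !mxE; field; rewrite !gt_eqF//.
pose t := Num.min 1 (del / 2).
have t1 : t <= 1 by rewrite ge_min lexx.
have t0 : 0 < t by rewrite lt_min ltr01 divr_gt0.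
have tdel : t < del.
  by apply: (@le_lt_trans _ _ (del / 2)); [rewrite ge_min lexx orbT|lra].
have := near0 t; rewrite gt_eqF// gtr0_norm// Nx => /(_ isT tdel).
have := near0 (- t); rewrite oppr_eq0 gt_eqF// normrN gtr0_norm// Nx.
move=> /(_ isT tdel); rewrite invrN mulrN opprK !ltr_norml => neg pos.
have lneg : 1 <= N (x + (- t) *: y).
  have := uv (t * a / c).
  rewrite !mulr_ge0 ?invr_ge0 ?(ltW t0) ?(ltW a0) ?(ltW c0)// => /(_ isT).
  by rewrite -scaleNr -!mulNr uE is_normZ// gtr0_norm// ler_pMr.
(* This is minus the quotient at [- t]. That quotient is nonpositive and within [eta / 2] of [l], so
   [l < eta / 2] and the quotient at [t] is below [eta]. *)
have qneg : 0 <= (N (x + (- t) *: y) - 1) / t.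
  by rewrite divr_ge0 ?(ltW t0)// subr_ge0.
have : (N (x + t *: y) - 1) / t <= eta by lra.
rewrite ler_pdivrMr// => Nxt.
exists (t * a / c); first by rewrite divr_gt0 ?mulr_gt0.
rewrite uE is_normZ// gtr0_norm//.
have Nxt0 := is_norm_ge0 N normN (x + t *: y).
have sq : N (x + t *: y) ^+ 2 <= 1 + 3 * eta * t.
  have et0 : 0 < eta * t by exact: mulr_gt0.
  have et1 : eta * t <= 1 by apply: mulr_ile1 => //; exact: ltW.
  rewrite -[3 * eta * t]mulrA; move: (eta * t) (N _) Nxt Nxt0 et0 et1 => *; nra.
have : a ^+ 2 * (3 * eta * t) <= e * (t * a / c).
  rewrite [leRHS]mulrA ler_pdivlMr//.
  have -> : a ^+ 2 * (3 * eta * t) * c = (eta * (3 * a * c)) * (t * a) by ring.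
  by rewrite ler_pM2r// mulr_gt0.
rewrite exprMn; have a2 : 0 <= a ^+ 2 by exact: sqr_ge0.
have := ler_wpM2l a2 sq; lra.
Qed.

(** Otherwise descent fails with step [1 / (k + 1)] at some index [f k >= k], for every [k]. At an
    accumulation point [q] of these bad points it holds with some step [s] and slack [e / 2]; by
    continuity it holds with slack [e] at nearby bad points, and chord monotonicity carries it down
    to their smaller steps. *)
Lemma uniform_descent (y : nat -> 'rV[R]_d) (v : 'rV[R]_d) (M : R) :
  (forall n, N (y n) <= M) ->
  (forall q, accumulation_point N y q -> forall e, 0 < e ->
    exists2 s, 0 < s & N (q + s *: v) ^+ 2 <= N q ^+ 2 + e * s) ->
  forall e, 0 < e -> exists2 s, 0 < s & exists m, forall n, (m <= n)%N ->
    N (y n + s *: v) ^+ 2 <= N (y n) ^+ 2 + e * s.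
Proof.
move=> yM accy e e0; apply: contrapT => H.
have bad (k : nat) : exists n, (k <= n)%N /\
    N (y n) ^+ 2 + e * k.+1%:R^-1 < N (y n + k.+1%:R^-1 *: v) ^+ 2.
  apply: contrapT => Hk; apply: H; exists k.+1%:R^-1; first by rewrite invr_gt0.
  exists k => n kn; rewrite leNgt; apply/negP => Hn; apply: Hk.
  by exists n.
have [f Hf] := choice bad.
have [q accq] := bounded_has_accumulation_point N normN (y \o f) M
  (fun n => yM (f n)).
have accyq : accumulation_point N y q.
  move=> r r0 m; have [k mk kr] := accq r r0 m.
  by exists (f k) => //; exact: leq_trans mk (Hf k).1.
have e20 : 0 < e / 2 by lra.
have [s s0 qs] := accy q accyq _ e20.
pose A := N (q + s *: v); pose B := N q.
have A0 : 0 <= A by exact: is_norm_ge0.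
have B0 : 0 <= B by exact: is_norm_ge0.
(* Moving from [q] to [w] costs at most [eta * (2 * A + 1)] in one square and [2 * eta * B] in the
   other. Their sum is strictly below [eta * D], which makes [key] strict. *)
pose D := 2 * A + 2 * B + 2.
have D0 : 0 < D by rewrite /D; lra.
pose eta := Num.min 1 (e / 2 * s / D).
have eta1 : eta <= 1 by rewrite ge_min lexx.
have eta0 : 0 < eta by rewrite lt_min ltr01 divr_gt0// mulr_gt0.
have etaD : eta * D <= e / 2 * s by rewrite -ler_pdivlMr// ge_min lexx orbT.
have [k mk Nk] := accq eta eta0 (Num.trunc s^-1).
have ks : k.+1%:R^-1 <= s.
  rewrite -[leRHS]invrK lef_pV2 ?posrE ?invr_gt0//.
  apply: le_trans (ltW (truncnS_gt _)) _.
  by rewrite ler_nat ltnS.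
have [_ fk] := Hf k; move: Nk fk => /=; set w := y (f k) => Nk fk.
have k0 : 0 < (k.+1%:R^-1 : R) <= s by rewrite ks andbT invr_gt0.
have ch := sqr_norm_chord w v _ _ k0.
have wA : N (w + s *: v) <= A + eta.
  have := is_norm_dist_trans N normN (q + s *: v) (w + s *: v) 0.
  rewrite !subr0 opprD addrACA subrr addr0 -/A; lra.
have wB : B - eta <= N w.
  have := is_norm_dist_trans N normN w q 0.
  by rewrite !subr0 (is_norm_distC N normN q) -/B; lra.
have W0 := is_norm_ge0 N normN (w + s *: v).
have W1 := is_norm_ge0 N normN w.
have wA2 : N (w + s *: v) ^+ 2 <= A ^+ 2 + eta * (2 * A + 1) by nra.
have wB2 : B ^+ 2 - 2 * eta * B <= N w ^+ 2 by case: (leP B eta) => ?; nra.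
have key : N (w + s *: v) ^+ 2 - N w ^+ 2 < e * s.
  move: qs etaD; rewrite -/A -/B /D; nra.
have : k.+1%:R^-1 * (N (w + s *: v) ^+ 2 - N w ^+ 2) < k.+1%:R^-1 * (e * s).
  by rewrite ltr_pM2l// invr_gt0.
have : s * (e * k.+1%:R^-1) < s * (N (w + k.+1%:R^-1 *: v) ^+ 2 - N w ^+ 2).
  by rewrite ltr_pM2l// ltrBrDl.
by move: (_^-1) ch => r; lra.
Qed.

End SmoothDescent.

(** * Resolvents of a nonexpansive map and their limit points *)

Section Nonexpansive.
Context {R : realType} {d : nat} (N : 'rV[R]_d -> R) (F : 'rV[R]_d -> 'rV[R]_d).
Hypotheses (normN : is_norm N) (nexpF : nonexpansive N F).

Let dist_trans := is_norm_dist_trans N normN.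
Let distC := is_norm_distC N normN.

Lemma nonexpansive_fix p x : F p = p -> N (F x - p) <= N (x - p).
Proof. by move=> pE; have := nexpF x p; rewrite pE. Qed.

Lemma accumulation_point_fix (u : nat -> 'rV[R]_d) p :
  (forall e, 0 < e -> exists m, forall n, (m <= n)%N -> N (u n - F (u n)) <= e) ->
  accumulation_point N u p -> F p = p.
Proof.
move=> ureg accp; apply/eqP; rewrite -subr_eq0; apply: contrapT => /negP Fp.
have r0 := is_norm_gt0 N normN _ Fp; set r := N _ in r0.
have r40 : 0 < r / 4 by lra.
have [m Hm] := ureg _ r40.
have [n mn Nn] := accp _ r40 m.
have : r < r; last by rewrite ltxx.
apply: (@le_lt_trans _ _ (N (F p - F (u n)) + N (F (u n) - u n) + N (u n - p))).
  rewrite /r; have := dist_trans (u n) (F p) p.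
  by have := dist_trans (F (u n)) (F p) (u n); lra.
have := Hm n mn; have := nexpF p (u n); rewrite (distC p) (distC (F (u n))); lra.
Qed.

Variable x0 : 'rV[R]_d.

(** The map [G] is a [t]-contraction. Its Picard iterates from [x0] stay within [N (x0 - p)] of [p],
    so they accumulate somewhere, and their vanishing increments make the accumulation point fixed
    by [G]. The distance bound follows from [Gp] at that point. *)
Lemma resolvent_exists (p : 'rV[R]_d) (t : R) : F p = p -> 0 <= t < 1 ->
  exists2 z, z = (1 - t) *: x0 + t *: F z & N (z - p) <= N (x0 - p).
Proof.
move=> pE /andP[t0 t1].
pose G x := (1 - t) *: x0 + t *: F x.
have GB x y : N (G x - G y) <= t * N (x - y).
  have -> : G x - G y = t *: (F x - F y).
    by apply/rowP => i; rewrite !mxE; ring.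
  by rewrite is_normZ// ger0_norm// ler_wpM2l.
have Gp x : N (G x - p) <= (1 - t) * N (x0 - p) + t * N (x - p).
  have -> : G x - p = (1 - t) *: (x0 - p) + t *: (F x - p).
    by apply/rowP => i; rewrite !mxE; ring.
  apply: le_trans (is_normD N normN _ _) _.
  rewrite !is_normZ// (ger0_norm t0) gtr0_norm ?subr_gt0// lerD2l ler_wpM2l//.
  exact: nonexpansive_fix.
pose y k := iter k G x0.
have yp k : N (y k - p) <= N (x0 - p).
  by elim: k => //= k IH; apply: le_trans (Gp _) _; nra.
have yy k : N (y k.+1 - y k) <= t ^+ k * N (y 1%N - x0).
  elim: k => [|k IH]; first by rewrite expr0 mul1r.
  by apply: le_trans (GB _ _) _; rewrite exprS -mulrA ler_wpM2l.
have [z accz] : exists z, accumulation_point N y z.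
  apply: (@bounded_has_accumulation_point _ _ N normN y (N (x0 - p) + N p)) => k.
  rewrite -{1}(subrK p (y k)); apply: le_trans (is_normD N normN _ _) _.
  by rewrite lerD2r.
have zE : G z = z.
  apply/eqP; rewrite -subr_eq0; apply: contrapT => /negP Gz.
  have r0 := is_norm_gt0 N normN _ Gz; set r := N _ in r0.
  have r40 : 0 < r / 4 by lra.
  have cvg_t : (fun k => t ^+ k * N (y 1%N - x0)) @ \oo --> (0 : R).
    rewrite -[X in _ --> X](mul0r (N (y 1%N - x0))); apply: cvgMl.
    by apply: cvg_expr; rewrite ger0_norm.
  have [m _ Hm] := @cvgr_dist_lt _ R^o _ _ _ _ _ cvg_t _ r40.
  have [n mn Nn] := accz _ r40 m.
  have : r < r; last by rewrite ltxx.
  apply: (@le_lt_trans _ _ (N (G z - G (y n)) + N (y n.+1 - y n) + N (y n - z))).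
    rewrite /r; have := dist_trans (y n) (G z) z.
    by have := dist_trans (G (y n)) (G z) (y n); rewrite /=; lra.
  have := Hm n mn; rewrite /= sub0r normrN => /(le_lt_trans (ler_norm _)).
  have := yy n; have := GB z (y n); rewrite (distC z) /=.
  have := is_norm_ge0 N normN (y n - z); nra.
exists z; first by rewrite -[LHS]zE.
have := Gp z; rewrite zE; nra.
Qed.

(* The accretivity of [id - F]: [x0 - z] is a positive multiple of [z - F z]. *)
Lemma resolvent_le (p z : 'rV[R]_d) (t l : R) : F p = p -> 0 < t < 1 ->
  z = (1 - t) *: x0 + t *: F z -> 0 <= l ->
  N (z - p) <= N (z - p + l *: (x0 - z)).
Proof.
move=> pE /andP[t0 t1] zE l0.
(* With this factor [l *: (x0 - z) = m *: (z - F z)]; the term [m *: (F z - p)] then completes a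
   multiple of [z - p]. *)
pose m := l * t / (1 - t).
have m0 : 0 <= m by rewrite divr_ge0 ?subr_ge0 ?(ltW t1)// mulr_ge0// ltW.
have t1N0 : 1 - t != 0 by rewrite subr_eq0 gt_eqF.
have E : (1 + m) *: (z - p) = z - p + l *: (x0 - z) + m *: (F z - p).
  apply/rowP => i; have := congr1 (fun w : 'rV[R]_d => w ord0 i) zE.
  rewrite !mxE => zi.
  have -> : x0 ord0 i = (z ord0 i - t * F z ord0 i) / (1 - t).
    by apply: (mulIf t1N0); rewrite divfK//; lra.
  by rewrite /m; field.
have := is_normD N normN (z - p + l *: (x0 - z)) (m *: (F z - p)).
rewrite -E !is_normZ// !ger0_norm//; last lra.
have := nonexpansive_fix p z pE; nra.
Qed.

(* In a smooth space the only such point is the value at [x0] of the sunny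
   nonexpansive retraction onto the fixed point set. *)
Lemma sunny_point : (exists p, F p = p) -> exists2 z, F z = z &
  forall p, F p = p -> forall l, 0 <= l ->
    N (z - p) <= N (z - p + l *: (x0 - z)).
Proof.
move=> [p0 p0E].
(* The shift by two keeps [t k] strictly inside the unit interval even for [k = 0]. *)
pose t (k : nat) : R := 1 - k.+2%:R^-1.
have t01 k : 0 < t k < 1.
  rewrite /t subr_gt0 invf_lt1 ?ltr0n// ltr1n/=.
  by rewrite ltrBlDr ltrDl invr_gt0.
have ex k : exists z, z = (1 - t k) *: x0 + t k *: F z /\
    N (z - p0) <= N (x0 - p0).
  have t01' : 0 <= t k < 1 by have /andP[/ltW -> ->] := t01 k.
  by have [z] := resolvent_exists p0 (t k) p0E t01'; exists z.
have [z Hz] := choice ex.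
have [q accq] : exists q, accumulation_point N z q.
  apply: (@bounded_has_accumulation_point _ _ N normN z (N (x0 - p0) + N p0)) => k.
  rewrite -{1}(subrK p0 (z k)); apply: le_trans (is_normD N normN _ _) _.
  by rewrite lerD2r (Hz k).2.
exists q.
  apply: (accumulation_point_fix z) => // e e0.
  pose B := 2 * N (x0 - p0) + 1.
  have B0 : 0 < B by have := is_norm_ge0 N normN (x0 - p0); rewrite /B; lra.
  exists (Num.trunc (B / e)) => n mn; have [zE zp] := Hz n.
  have -> : z n - F (z n) = n.+2%:R^-1 *: (x0 - F (z n)).
    apply/rowP => i; have := congr1 (fun w : 'rV[R]_d => w ord0 i) zE.
    by rewrite !mxE /t => zi; rewrite {1}zi; ring.
  rewrite is_normZ// gtr0_norm ?invr_gt0// ler_pdivrMl//.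
  apply: (@le_trans _ _ B).
    have := dist_trans p0 x0 (F (z n)); rewrite (distC p0).
    by have := nonexpansive_fix p0 (z n) p0E; rewrite /B; lra.
  rewrite -ler_pdivrMr//; apply: le_trans (ltW (truncnS_gt _)) _.
  by rewrite ler_nat ltnS; exact: leq_trans mn _.
move=> p pE l l0; apply/ler_addgt0Pr => e e0.
(* Replacing [z n] by [q] costs [N (z n - q)] on the left and at most [1 + l] times that on the
   right. *)
have e0' : 0 < e / (2 + l) by rewrite divr_gt0//; lra.
have [n _ Nn] := accq _ e0' 0%N.
have := resolvent_le p (z n) (t n) l pE (t01 n) (Hz n).1 l0.
have := dist_trans (z n) q p; rewrite (distC q (z n)).
set w := z n in Nn *.
have wE : w - p + l *: (x0 - w) = (q - p + l *: (x0 - q)) + (1 - l) *: (w - q).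
  by apply/rowP => i; rewrite !mxE; ring.
have := is_normD N normN (q - p + l *: (x0 - q)) ((1 - l) *: (w - q)).
rewrite -wE is_normZ//.
have : `|1 - l| <= 1 + l by rewrite ler_norml; lra.
move: Nn; rewrite ltr_pdivlMr; last lra.
have := is_norm_ge0 N normN (w - q); nra.
Qed.

(** * Halpern iterates along one noise realization *)

Context {Omega : Type} (beta : nat -> R) (U : nat -> Omega -> 'rV[R]_d)
  (w : Omega) (E : R).
Hypotheses (beta01 : forall n, (1 <= n)%N -> 0 < beta n < 1)
  (beta_nd : forall m n, (1 <= m)%N -> (m <= n)%N -> beta m <= beta n)
  (beta_cvg1 : forall e, 0 < e ->
     exists m, forall n, (m <= n)%N -> 1 - beta n.+1 <= e)
  (beta_div : forall A, exists n, A <= \sum_(0 <= k < n) (1 - beta k.+1))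
  (noise_sum : forall n, \sum_(0 <= k < n) N (U k.+1 w) <= E).

Local Notation x n := (halpern F beta U x0 n w).
Local Notation e n := (N (U n w)).

Let noise_ge0 n : 0 <= e n. Proof. exact: is_norm_ge0. Qed.

Let E_ge0 : 0 <= E. Proof. by have := noise_sum 0; rewrite big_geq. Qed.

(** Up to noise, [x n.+1 - p] is a convex combination of [x0 - p] and [F (x n) - p]; by induction
    the distance to [p] exceeds [N (x0 - p)] by at most the accumulated noise. *)
Lemma halpern_bounded p n : F p = p -> N (x n - p) <= N (x0 - p) + E.
Proof.
move=> pE; apply: (@le_trans _ _ (N (x0 - p) + \sum_(0 <= k < n) e k.+1)).
  elim: n => [|n IH]; first by rewrite big_geq// addr0.
  have /andP[b0 b1] := beta01 n.+1 isT.
  have -> : x n.+1 - p = (1 - beta n.+1) *: (x0 - p)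
      + beta n.+1 *: ((F (x n) - p) + U n.+1 w).
    by apply/rowP => i; rewrite !mxE; ring.
  apply: le_trans (is_normD N normN _ _) _.
  rewrite !is_normZ// (gtr0_norm b0) gtr0_norm ?subr_gt0//.
  have := is_normD N normN (F (x n) - p) (U n.+1 w).
  have := nonexpansive_fix p (x n) pE; rewrite big_nat_recr//=.
  have S0 : 0 <= \sum_(0 <= k < n) e k.+1 by apply: sumr_ge0.
  have := noise_ge0 n.+1; move: IH S0.
  move: (N (x0 - p)) (N (x n - p)) (N (F (x n) - p)) (e n.+1)
    (N (_ + U _ _)) (\sum_(_ <= _ < _) _).
  move=> X D D' en Y S DX S0 en0 D'D YD.
  have : beta n.+1 * Y <= beta n.+1 * (X + S + en) by rewrite ler_pM2l//; lra.
  have : 0 <= (1 - beta n.+1) * (S + en) by rewrite mulr_ge0//; lra.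
  lra.
by rewrite lerD2l.
Qed.

Lemma halpern_dist_anchor p n : F p = p ->
  N (x0 - F (x n)) <= 2 * N (x0 - p) + E.
Proof.
move=> pE; have := dist_trans p x0 (F (x n)); rewrite (distC p).
have := nonexpansive_fix p (x n) pE; have := halpern_bounded p n pE; lra.
Qed.

Lemma halpern_noise_vanishes r : 0 < r ->
  exists m, forall n, (m <= n)%N -> e n.+1 <= r.
Proof.
move=> r0.
have [m Hm] := bounded_sum_tail (fun k => e k.+1) E (fun k => noise_ge0 k.+1)
  noise_sum r r0.
exists m => n mn; have := Hm n.+1 (leqW mn); rewrite big_nat_recr//=.
have : 0 <= \sum_(m <= k < n) e k.+1 by apply: sumr_ge0.
lra.
Qed.

(** Consecutive differences satisfy the contractive recursion with [delta = 0]. The change of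
    anchoring weight contributes a telescoping error and the noises a summable one. The displacement
    [x n.+1 - F (x n)] vanishes separately, since [beta] tends to 1. *)
Lemma halpern_regular : (exists p, F p = p) -> forall r, 0 < r ->
  exists m, forall n, (m <= n)%N -> N (x n - F (x n)) <= r.
Proof.
move=> [p pE] r r0.
pose K := 2 * N (x0 - p) + E.
have K0 : 0 <= K.
  by have := is_norm_ge0 N normN (x0 - p); rewrite /K; have := E_ge0; lra.
pose c n := (beta n.+2 - beta n.+1) * K + (e n.+2 + e n.+1).
have db n : 0 <= beta n.+2 - beta n.+1 by rewrite subr_ge0 beta_nd.
have c0 n : 0 <= c n by rewrite addr_ge0 ?mulr_ge0// addr_ge0.
have cM n : \sum_(0 <= k < n) c k <= K + (E + E).
  rewrite !big_split/= -mulr_suml.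
  rewrite (@telescope_sumr _ _ _ (fun k => beta k.+1))//.
  have := beta01 n.+1 isT; have := beta01 1 isT.
  have := noise_sum n; have := noise_sum n.+1.
  rewrite big_nat_recl//=; have := noise_ge0 1; nra.
have rec n : (0 <= n)%N -> N (x n.+2 - x n.+1) <=
    beta n.+1 * N (x n.+1 - x n) + (1 - beta n.+1) * 0 + c n.
  move=> _; have /andP[b0 b1] := beta01 n.+1 isT.
  have /andP[b0' b1'] := beta01 n.+2 isT.
  (* Splitting off the weight [beta n.+1], not [beta n.+2], leaves [F (x n.+1) - x0] as the only
     vector multiplied by the increment of [beta]. *)
  have -> : x n.+2 - x n.+1 = beta n.+1 *: (F (x n.+1) - F (x n))
    + ((beta n.+2 - beta n.+1) *: (F (x n.+1) - x0)
    + (beta n.+2 *: U n.+2 w - beta n.+1 *: U n.+1 w)).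
    rewrite [x n.+2]/= -/(x n.+1); set X := x n.+1.
    rewrite {1 2}/X [X in _ - X]/=.
    by apply/rowP => i; rewrite !mxE; ring.
  rewrite mulr0 addr0.
  apply: le_trans (is_normD N normN _ _) _; rewrite is_normZ// gtr0_norm//.
  apply: lerD; first by rewrite ler_pM2l//; exact: nexpF.
  apply: le_trans (is_normD N normN _ _) _; rewrite is_normZ// ger0_norm//.
  apply: lerD.
    by rewrite ler_wpM2l// distC; exact: halpern_dist_anchor.
  apply: le_trans (is_normB N normN _ _) _; rewrite !is_normZ// !gtr0_norm//.
  have := noise_ge0 n.+1; have := noise_ge0 n.+2; nra.
have b01 n : 0 <= beta n.+1 <= 1 by have /andP[/ltW-> /ltW->] := beta01 n.+1 isT.
have r30 : 0 < r / 3 by lra.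
have [m1 H1] := recursion_eventually_le (fun n => N (x n.+1 - x n)) _ _ _ _ 0
  b01 c0 cM beta_div rec _ r30.
have [m2 H2] := halpern_noise_vanishes _ r30.
(* One third of [r] each goes to the consecutive difference, the noise and the anchoring term;
   [K + 1] stays positive even if [K = 0]. *)
have rK0 : 0 < r / 3 / (K + 1) by rewrite divr_gt0//; lra.
have [m3 H3] := beta_cvg1 _ rK0.
exists (maxn m1 (maxn m2 m3)) => n; rewrite !geq_max => /and3P[n1 n2 n3].
have /andP[b0 b1] := beta01 n.+1 isT.
have := H1 n n1; have := H2 n n2; have := H3 n n3.
rewrite ler_pdivlMr; last lra.
have := dist_trans (x n.+1) (x n) (F (x n)); rewrite (distC (x n) (x n.+1)).
have -> : x n.+1 - F (x n) = (1 - beta n.+1) *: (x0 - F (x n)) + beta n.+1 *: U n.+1 w.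
  by apply/rowP => i; rewrite !mxE; ring.
have := is_normD N normN ((1 - beta n.+1) *: (x0 - F (x n))) (beta n.+1 *: U n.+1 w).
rewrite !is_normZ// (gtr0_norm b0) gtr0_norm ?subr_gt0//.
have := halpern_dist_anchor p n pE; rewrite -/K.
have := noise_ge0 n.+1.
move: (N (x n.+1 - x n)) (e n.+1) (N (x0 - F (x n))) => a en L en0 LK.
have : (1 - beta n.+1) * L <= (1 - beta n.+1) * K by rewrite ler_wpM2l// subr_ge0 ltW.
have : beta n.+1 * en <= en by nra.
lra.
Qed.

Lemma halpern_accumulation_point_fix p : (exists p, F p = p) ->
  accumulation_point N (fun n => x n) p -> F p = p.
Proof. by move=> /halpern_regular; exact: accumulation_point_fix. Qed.

(** Uniform descent supplies one fixed step [s]; once [1 - beta n.+1 <= s], the chord inequality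
    transfers it to the actual step of the iteration. This gives the contractive recursion for
    squared distances to [z]. *)
Lemma halpern_converges : (exists p, F p = p) -> smooth_norm N ->
  exists2 z, F z = z & forall r, 0 < r ->
    exists m, forall n, (m <= n)%N -> N (x n - z) <= r.
Proof.
move=> Fix smN; have [z zE zle] := sunny_point Fix.
exists z => // r r0.
pose v := x0 - z.
(* Removing the anchoring displacement leaves a base point whose norm is at most [beta n.+1] times
   the previous distance plus noise. *)
pose y n := beta n.+1 *: (F (x n) + U n.+1 w - z).
have xE n : x n.+1 - z = y n + (1 - beta n.+1) *: v.
  by apply/rowP => i; rewrite !mxE; ring.
pose B := N v + E.
have v0 : 0 <= N v by exact: is_norm_ge0.
have xB n : N (x n - z) <= B by exact: halpern_bounded.
have eE n : e n.+1 <= E.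
  have := noise_sum n.+1; rewrite big_nat_recr//=.
  have : 0 <= \sum_(0 <= k < n) e k.+1 by apply: sumr_ge0.
  lra.
have yle n : N (y n) <= beta n.+1 * (N (x n - z) + e n.+1).
  have /andP[b0 _] := beta01 n.+1 isT.
  rewrite is_normZ// gtr0_norm// ler_pM2l// addrAC.
  apply: le_trans (is_normD N normN _ _) _.
  by rewrite lerD2r; exact: nonexpansive_fix.
have yB n : N (y n) <= B + E.
  apply: le_trans (yle n) _; have /andP[b0 b1] := beta01 n.+1 isT.
  have := xB n; have := eE n; have := noise_ge0 n.+1.
  have := is_norm_ge0 N normN (x n - z); nra.
have accy q : accumulation_point N y q -> forall s, 0 < s ->
    exists2 t, 0 < t & N (q + t *: v) ^+ 2 <= N q ^+ 2 + s * t.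
  move=> accq s s0; apply: smooth_descent => // l l0.
  (* Since the anchoring displacement vanishes, [q + z] is an accumulation point of the iterates.
     The inequality for [z] at this fixed point is the hypothesis of [smooth_descent] at [q]. *)
  have Fqz : F (q + z) = q + z.
    apply: halpern_accumulation_point_fix => // h h0 m.
    have h20 : 0 < h / 2 by lra.
    have hv0 : 0 < h / 2 / (N v + 1) by rewrite divr_gt0//; lra.
    have [m' Hm'] := beta_cvg1 _ hv0.
    have [n] := accq _ h20 (maxn m m'); rewrite geq_max => /andP[mn m'n] Nn.
    exists n.+1; first exact: leqW.
    have -> : x n.+1 - (q + z) = (y n - q) + (1 - beta n.+1) *: v.
      by rewrite opprD addrA addrAC xE addrAC.
    apply: le_lt_trans (is_normD N normN _ _) _.
    have /andP[b0 b1] := beta01 n.+1 isT.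
    rewrite is_normZ// gtr0_norm ?subr_gt0//.
    have := Hm' n m'n; rewrite ler_pdivlMr; last lra.
    nra.
  have := zle _ Fqz l l0; rewrite opprD addrCA subrr addr0 is_normN//.
  by rewrite -(is_normN N normN (q - _)) opprB addrC.
(* Half of [r ^+ 2] is the descent slack, which becomes [delta]; the other half is the margin in the
   recursion lemma. *)
have h0 : 0 < r ^+ 2 / 2 by rewrite divr_gt0// exprn_gt0.
have [s s0 [m1 Hm1]] := uniform_descent N normN y v _ yB accy _ h0.
have [m2 Hm2] := beta_cvg1 _ s0.
(* This bounds the noise cost [(D + en) ^+ 2 - D ^+ 2 = (2 * D + en) * en] for [D <= B] and
   [en <= E]. *)
pose c n := (2 * B + E) * e n.+1.
have B0 : 0 <= B by rewrite addr_ge0.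
have c0 n : 0 <= c n by rewrite mulr_ge0// addr_ge0// mulr_ge0.
have cM n : \sum_(0 <= k < n) c k <= (2 * B + E) * E.
  by rewrite -mulr_sumr ler_wpM2l// addr_ge0// mulr_ge0.
have b01 n : 0 <= beta n.+1 <= 1 by have /andP[/ltW-> /ltW->] := beta01 n.+1 isT.
have rec n : (maxn m1 m2 <= n)%N -> N (x n.+1 - z) ^+ 2 <=
    beta n.+1 * N (x n - z) ^+ 2 + (1 - beta n.+1) * (r ^+ 2 / 2) + c n.
  rewrite geq_max => /andP[n1 n2]; have /andP[b0 b1] := beta01 n.+1 isT.
  have bs : 0 < 1 - beta n.+1 <= s by rewrite subr_gt0 b1 Hm2.
  have chord := sqr_norm_chord N normN (y n) v _ _ bs; rewrite -xE in chord.
  have [b0' _] := andP bs.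
  have := Hm1 n n1; rewrite -lerBlDl -(ler_pM2l b0') => /(le_trans chord).
  rewrite [leRHS]mulrA [leRHS]mulrC ler_pM2l//.
  have : N (y n) ^+ 2 <= beta n.+1 * N (x n - z) ^+ 2 + c n; last lra.
  have Ny0 := is_norm_ge0 N normN (y n).
  have Nx0 := is_norm_ge0 N normN (x n - z).
  apply: (@le_trans _ _ ((beta n.+1 * (N (x n - z) + e n.+1)) ^+ 2)).
    by rewrite ler_sqr ?nnegrE//; exact: le_trans (yle n).
  rewrite /c; have := xB n; have := eE n; have := noise_ge0 n.+1.
  move: (N (x n - z)) (e n.+1) Nx0 => D en D0 en0 enE DB.
  have b2 : beta n.+1 ^+ 2 <= beta n.+1 by nra.
  have : (beta n.+1 * (D + en)) ^+ 2 <= beta n.+1 * (D + en) ^+ 2.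
    by rewrite exprMn ler_wpM2r// sqr_ge0.
  have sqE : (D + en) ^+ 2 - D ^+ 2 = (2 * D + en) * en by ring.
  have sq0 : 0 <= (1 - beta n.+1) * ((D + en) ^+ 2 - D ^+ 2).
    by rewrite sqE; apply: mulr_ge0; [exact: ltW|apply: mulr_ge0 => //; lra].
  have : (D + en) ^+ 2 - D ^+ 2 <= (2 * B + E) * en.
    by rewrite sqE ler_wpM2r//; lra.
  lra.
have [m Hm] := recursion_eventually_le (fun n => N (x n - z) ^+ 2) _ _ _ _ _
  b01 c0 cM beta_div rec _ h0.
exists m => n mn; have := Hm n mn; rewrite -splitr.
by rewrite ler_sqr// nnegrE; [exact: is_norm_ge0|exact: ltW].
Qed.

End Nonexpansive.

(** * Almost sure summability of the noise *)

Lemma eventually_le_cvg0 {R : realType} (s : nat -> R) : (forall n, 0 <= s n) ->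
  (forall r, 0 < r -> exists m, forall n, (m <= n)%N -> s n <= r) ->
  s @ \oo --> (0 : R).
Proof.
move=> s0 Hs; apply/cvgrPdist_le => r r0; have [m Hm] := Hs r r0.
by exists m => // n /= mn; rewrite sub0r normrN ger0_norm// Hm.
Qed.

(** The integral of a nonnegative function is a supremum over the simple functions below it, and a
    larger function admits more of them. This allows a comparison with [N (U n w)] without first
    establishing its measurability. *)
Lemma ge0_le_integral_nonmeasurable {R : realType} {dO : measure_display}
    (Omega : measurableType dO) (mu : {measure set Omega -> \bar R})
    (f g : Omega -> \bar R) :
  (forall w, 0 <= f w)%E -> (forall w, f w <= g w)%E ->
  (\int[mu]_w f w <= \int[mu]_w g w)%E.
Proof.
move=> f0 fg; have g0 w : (0 <= g w)%E by exact: le_trans (fg w).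
rewrite !ge0_integralTE//; apply: ge_ereal_sup => _ [h /= hf <-].
by apply: ereal_sup_ubound; exists h => // w; exact: le_trans (fg w).
Qed.

(** By monotone convergence the sum of the series has a finite integral, hence is finite almost
    everywhere; its value bounds the partial sums. *)
Lemma ae_summable {R : realType} {dO : measure_display}
    (Omega : measurableType dO) (mu : {measure set Omega -> \bar R})
    (g : nat -> Omega -> R) :
  (forall n, measurable_fun setT (g n)) -> (forall n w, 0 <= g n w) ->
  (\sum_(0 <= n <oo) \int[mu]_w (g n w)%:E < +oo)%E ->
  {ae mu, forall w, exists M, forall n, \sum_(0 <= k < n) g k w <= M}.
Proof.
move=> mg g0 gfin.
have mG n : measurable_fun setT (fun w => (g n w)%:E) by exact/measurable_EFinP.
have G0 n w : setT w -> (0 <= (g n w)%:E)%E by move=> _; rewrite lee_fin.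
have S0 w : (0 <= \sum_(0 <= n <oo) (g n w)%:E)%E.
  by apply: nneseries_ge0 => n _ _; rewrite lee_fin.
have intS : mu.-integrable setT (fun w => \sum_(0 <= n <oo) (g n w)%:E)%E.
  apply/integrableP; split.
    by apply: ge0_emeasurable_sum => // n w _ _; exact: G0.
  under eq_integral do rewrite gee0_abs//.
  by rewrite integral_nneseries.
have := integrable_ae measurableT intS; apply: filterS => w /(_ I) fin.
exists (fine (\sum_(0 <= n <oo) (g n w)%:E)) => n.
rewrite -lee_fin fineK// -sumEFin.
by apply: nneseries_lim_ge => k _; rewrite lee_fin.
Qed.

Section Noise.
Context {R : realType} {d : nat} (N : 'rV[R]_d -> R).
Hypothesis normN : is_norm N.

Lemma coord_sum_le_is_norm : exists2 C, 0 < C & forall x, coord_sum x <= C * N x.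
Proof.
have [C C0 NC] := mx_norm_le_is_norm N normN.
exists (C * (1 + d%:R)); first by rewrite mulr_gt0// ltr_wpDr.
move=> x; have : coord_sum x <= \sum_(i < d) `|x|.
  by apply: ler_sum => i _; exact: coord_le_mx_norm.
rewrite sumr_const card_ord -[_ *+ _]mulr_natl.
have : d%:R * `|x| <= d%:R * (C * N x) by rewrite ler_wpM2l.
have : 0 <= C * N x by apply: mulr_ge0; [exact: ltW|exact: is_norm_ge0].
rewrite mulrAC mulrDr mulr1 [_ * d%:R]mulrC; lra.
Qed.

Lemma ae_noise_summable {dO : measure_display} (Omega : measurableType dO)
    (mu : {measure set Omega -> \bar R}) (U : nat -> Omega -> 'rV[R]_d) :
  (forall n i, (1 <= n)%N -> measurable_fun setT (fun w => U n w ord0 i)) ->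
  (\sum_(1 <= n <oo) \int[mu]_w (N (U n w))%:E < +oo)%E ->
  {ae mu, forall w, exists M, forall n, \sum_(0 <= k < n) N (U k.+1 w) <= M}.
Proof.
move=> mU NUfin.
have [C C0 NC] := coord_sum_le_is_norm.
have [C' C'0 NC'] := is_norm_le_coord_sum N normN.
(* The coordinate sum is measurable because the coordinates are. The factor [C^-1] puts it below
   [N], and [C' * C] later recovers a bound on [N]. The index shift reflects that the noise starts
   at 1. *)
pose g n w := C^-1 * coord_sum (U n.+1 w).
have g0 n w : 0 <= g n w.
  by apply: mulr_ge0; [rewrite invr_ge0 ltW|exact: sumr_ge0].
have mg n : measurable_fun setT (g n).
  apply: measurable_funM => //; apply: measurable_sum => i.
  by apply: measurableT_comp => //; exact: mU.
have gfin : (\sum_(0 <= n <oo) \int[mu]_w (g n w)%:E < +oo)%E.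
  apply: le_lt_trans NUfin.
  have I0 n : (0 <= \int[mu]_w (N (U n w))%:E)%E.
    by apply: integral_ge0 => w _; rewrite lee_fin; exact: is_norm_ge0.
  rewrite -(nneseries_addn 1 I0).
  apply: lee_nneseries => [n _ _|n _].
    by apply: integral_ge0 => w _; rewrite lee_fin.
  rewrite addn1; apply: ge0_le_integral_nonmeasurable => w; rewrite lee_fin//.
  by rewrite /g ler_pdivrMl.
have := ae_summable _ mu g mg g0 gfin; apply: filterS => w [M HM].
exists (C' * (C * M)) => n.
apply: (@le_trans _ _ (C' * (C * \sum_(0 <= k < n) g k w))).
  rewrite !mulr_sumr; apply: ler_sum => k _.
  by rewrite /g mulVKf ?gt_eqF// NC'.
by rewrite !ler_pM2l.
Qed.

End Noise.

Theorem theorem3 (R : realType) (d : nat) (N : 'rV[R]_d -> R)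
  (F : 'rV[R]_d -> 'rV[R]_d) (beta : nat -> R)
  (dO : measure_display) (Omega : measurableType dO) (P : probability Omega R)
  (U : nat -> Omega -> 'rV[R]_d) (x0 : 'rV[R]_d) :
  is_norm N ->
  nonexpansive N F ->
  (exists p, F p = p) ->
  beta 0%N = 0 ->
  (forall n, (1 <= n)%N -> 0 < beta n < 1) ->
  (forall m n, (1 <= m)%N -> (m <= n)%N -> beta m <= beta n) ->
  beta @ \oo --> (1 : R) ->
  (fun n => \sum_(1 <= j < n.+1) (1 - beta j)) @ \oo --> +oo ->
  cvg ((fun n => \sum_(1 <= j < n.+1) (beta j - beta j.-1)) @ \oo) ->
  (forall n (i : 'I_d), (1 <= n)%N ->
     P.-integrable setT (fun w => (U n w ord0 i)%:E) /\
     (\int[P]_w (U n w ord0 i)%:E = 0)%E) ->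
  (\sum_(1 <= n <oo) \int[P]_w (N (U n w))%:E < +oo)%E ->
  (* (a) *)
  ({ae P, forall w, (fun n => N (halpern F beta U x0 n w - F (halpern F beta U x0 n w)))
                       @ \oo --> (0 : R)}
   /\ {ae P, forall w, forall p, accumulation_point N (fun n => halpern F beta U x0 n w) p ->
                         F p = p})
  /\
  (* (b) *)
  (smooth_norm N ->
   {ae P, forall w, exists2 xs, F xs = xs &
            (fun n => N (halpern F beta U x0 n w - xs)) @ \oo --> (0 : R)}).
Proof.
move=> normN nexpF Fix _ beta01 beta_nd beta_cvg beta_dvg _ intU NUfin.
have beta1 e : 0 < e -> exists m, forall n, (m <= n)%N -> 1 - beta n.+1 <= e.
  move=> e0; have [m _ Hm] := @cvgr_dist_lt _ R^o _ _ _ _ _ beta_cvg _ e0.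
  exists m => n mn; apply: le_trans (ler_norm _) _.
  by apply: ltW; apply: Hm => /=; exact: leqW.
have beta_div A : exists n, A <= \sum_(0 <= k < n) (1 - beta k.+1).
  have /cvgryPge/(_ A)[m _ Hm] := beta_dvg.
  by exists m; have := Hm m (leqnn m); rewrite /= big_add1.
have mU n i : (1 <= n)%N -> measurable_fun setT (fun w => U n w ord0 i).
  by move=> n1; have [/measurable_int/measurable_EFinP] := intU n i n1.
have sumU := ae_noise_summable N normN _ P U mU NUfin.
have N0 := is_norm_ge0 N normN.
(* All three claims hold on the same event, where the noise norms have partial sums bounded by some
   [M] depending on [w]. *)
split; [split|move=> smN]; move: sumU; apply: filterS => w [M HM].
- apply: eventually_le_cvg0 => [n|r r0]; first exact: N0.
  exact: (@halpern_regular _ _ N F normN nexpF x0 _ beta U w M).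
- by move=> p; apply: (@halpern_accumulation_point_fix _ _ N F normN nexpF x0 _ beta U w M).
- have [z zE Hz] := @halpern_converges _ _ N F normN nexpF x0 _ beta U w M
    beta01 beta_nd beta1 beta_div HM Fix smN.
  by exists z => //; apply: eventually_le_cvg0.
Qed.
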